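(* Gandy's superjump $\mathbb{S}$ is computable (in the sense of Kleene's S1–S9) in any functional $\Theta$ satisfying $\mathsf{SCF}(\Theta)$ together with the Suslin functional $S$.
   Context: The metatheory is $\mathsf{ZFC}$, and ''computable'' means computable by Kleene's schemes S1–S9 for higher-order computation over the full finite type hierarchy; $\{e\}(F,\dots)$ denotes the S1–S9 computation with index $e$ on the given inputs. Type $0$ is $\mathbb{N}$, type $1$ is $\mathbb{N}^{\mathbb{N}}$, type $2$ consists of the functionals $\mathbb{N}^{\mathbb{N}}\to\mathbb{N}$, and $1^*$ is the type of finite sequences of type-$1$ objects. Write $\overline{g}n=\langle g(0),\dots,g(n-1)\rangle$. The superjump is $\mathbb{S}(F^2,e^0)=0$ if $\{e\}(F)$ terminates, and $=1$ otherwise ($e$ an S1–S9 index). The Suslin functional $S^2$ satisfies $S(f)=0$ if $(\exists g\in\mathbb{N}^{\mathbb{N}})(\forall n)(f(\overline{g}n)=0)$ (with finite sequences coded as numbers), and $S(f)=1$ otherwise. For $\Theta^{2\to1^*}$, $\mathsf{SCF}(\Theta)$ is the statement: for all $G^2$ and all $f\in 2^{\mathbb{N}}$ there is an element $g$ of the finite sequence $\Theta(G)$ such that $\overline{f}G(g)=\overline{g}G(g)$ (i.e. the neighbourhoods $[\overline{g}G(g)]$ for $g\in\Theta(G)$ cover Cantor space $2^{\mathbb{N}}$). *)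

(* Defs.v *)
From Stdlib Require List.
From mathcomp Require Import all_boot.
From mathcomp Require Import boolp.

Set Implicit Arguments.
Unset Strict Implicit.
Unset Printing Implicit Defensive.

(** * The full finite type hierarchy over nat *)

Inductive ftype : Type :=
| TNat
| TArr of ftype & ftype.

Fixpoint interp (s : ftype) : Type :=
  if s is TArr s1 s2 then interp s1 -> interp s2 else nat.

Definition ty0 : ftype := TNat.
Definition ty1 : ftype := TArr ty0 ty0.
Definition ty2 : ftype := TArr ty1 ty0.

(* Every type is s_1 -> ... -> s_k -> 0; [args s] is the type of the tuples
   (xi_1, ..., xi_k) with xi_i of type s_i, so [app x xi] is a number. *)
Fixpoint args (s : ftype) : Type :=
  if s is TArr s1 s2 then (interp s1 * args s2)%type else unit.

Fixpoint app (s : ftype) : interp s -> args s -> nat :=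
  match s with
  | TNat => fun n _ => n
  | TArr s1 s2 => fun x xi => app (x xi.1) xi.2
  end.

Definition object : Type := {s : ftype & interp s}.

Definition obj (s : ftype) (x : interp s) : object := existT interp s x.

Fixpoint objs (s : ftype) : args s -> seq object :=
  match s with
  | TNat => fun _ => [::]
  | TArr s1 s2 => fun xi => obj xi.1 :: objs xi.2
  end.

(** * Kleene's schemes S1-S9 *)

Definition pack : seq nat -> nat := CodeSeq.code.

Fixpoint ftype_code (s : ftype) : nat :=
  if s is TArr s1 s2 then pack [:: ftype_code s1; ftype_code s2] else pack [::].

(* As in Kleene's definition, an index records the types of the arguments
   it is meant for, and it computes nothing on arguments of other types. *)
Definition signature (Phi : seq object) : nat :=
  pack [seq ftype_code (tag x) | x <- Phi].

(* [computes e Phi a] is {e}(Phi) = a.  Two points go beyond pure types: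
   - all arguments form one list, and S6 moves any of them to the front;
   - S8 is {e}(F, Phi) = F (fun xi_1 => {d_1}(xi_1, F, Phi)) ...
                           (fun xi_k => {d_k}(xi_k, F, Phi))
     for F of type s_1 -> ... -> s_k -> 0, where each xi_i is a tuple of
     arguments for s_i; [applies Phi ds F a] says that the application of F
     to the functionals fun xi_i => {d_i}(xi_i, Phi) is defined, which needs
     each of them to be total, and has value a. *)
Inductive computes : nat -> seq object -> nat -> Prop :=
| S1 (x : nat) Phi :
    let Psi := @obj ty0 x :: Phi in
    computes (pack [:: 1; signature Psi]) Psi x.+1
| S2 (q : nat) Phi :
    computes (pack [:: 2; signature Phi; q]) Phi q
| S3 (x : nat) Phi :
    let Psi := @obj ty0 x :: Phi in
    computes (pack [:: 3; signature Psi]) Psi x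
| S4 (g h : nat) Phi (x a : nat) :
    computes h Phi x ->
    computes g (@obj ty0 x :: Phi) a ->
    computes (pack [:: 4; signature Phi; g; h]) Phi a
| S5_zero (g h : nat) Phi (a : nat) :
    let Psi := @obj ty0 0 :: Phi in
    computes g Phi a ->
    computes (pack [:: 5; signature Psi; g; h]) Psi a
| S5_succ (g h x : nat) Phi (b a : nat) :
    let Psi := @obj ty0 x.+1 :: Phi in
    computes (pack [:: 5; signature Psi; g; h]) (@obj ty0 x :: Phi) b ->
    computes h (@obj ty0 x :: @obj ty0 b :: Phi) a ->
    computes (pack [:: 5; signature Psi; g; h]) Psi a
| S6 (g : nat) (y : object) Phi Phi' (a : nat) :
    let Psi := Phi ++ y :: Phi' in
    computes g (y :: Phi ++ Phi') a ->
    computes (pack [:: 6; signature Psi; size Phi; g]) Psi a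
| S7 (f : nat -> nat) (x : nat) Phi :
    let Psi := @obj ty1 f :: @obj ty0 x :: Phi in
    computes (pack [:: 7; signature Psi]) Psi (f x)
| S8 (ds : seq nat) (s t : ftype) (F : interp (TArr s t)) Phi (a : nat) :
    let Psi := obj F :: Phi in
    applies Psi ds F a ->
    computes (pack [:: 8, signature Psi & ds]) Psi a
| S9 (m x : nat) Phi (a : nat) :
    let Psi := @obj ty0 x :: Phi in
    m <= size Phi ->
    computes x (take m Phi) a ->
    computes (pack [:: 9; signature Psi; m]) Psi a
with applies : seq object -> seq nat -> forall s : ftype, interp s -> nat -> Prop :=
| applies_nil Phi (a : nat) :
    @applies Phi [::] TNat a a
| applies_cons Phi (d : nat) (ds : seq nat) (s t : ftype)
    (F : interp s -> interp t) (y : interp s) (a : nat) :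
    (forall xi : args s, computes d (objs xi ++ Phi) (app y xi)) ->
    @applies Phi ds t (F y) a ->
    @applies Phi (d :: ds) (TArr s t) F a.

Definition terminates (e : nat) (Phi : seq object) : Prop :=
  exists a, computes e Phi a.

Definition computable_in (Psi : seq object) (s : ftype) (x : interp s) : Prop :=
  exists e : nat, forall xi : args s, computes e (Psi ++ objs xi) (app x xi).

(** * The functionals *)

Definition superjump : interp (TArr ty2 (TArr ty0 ty0)) :=
  fun (F : interp ty2) (e : nat) =>
    if `[< terminates e [:: @obj ty2 F] >] then 0 else 1.

Definition suslin : interp ty2 :=
  fun f : nat -> nat =>
    if `[< exists g : nat -> nat, forall n, f (pack (mkseq g n)) = 0 >]
    then 0 else 1.

Definition SCF (Theta : interp ty2 -> seq (interp ty1)) : Prop :=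
  forall (G : interp ty2) (f : nat -> nat), (forall n, f n < 2) ->
    exists g : nat -> nat, List.In g (Theta G) /\ mkseq f (G g) = mkseq g (G g).

(* A functional of type 2 -> 1^* is given to a computation as its length
   function G |-> |Theta(G)|, of type 2 -> 0, and its entry function
   (G, i) |-> Theta(G)_i, of type 2 -> (0 -> 1); the entries at
   i >= |Theta(G)| carry no information and are set to the zero function. *)
Definition seq_functional (Theta : interp ty2 -> seq (interp ty1)) :
    seq object :=
  [:: @obj (TArr ty2 ty0) (fun G => size (Theta G));
      @obj (TArr ty2 (TArr ty0 ty1)) (fun G i => nth (fun=> 0) (Theta G) i)].

(* Main.v *)
(* The computations with argument F form the graph X of a partial function on
   codes of configurations, the least fixed point of an inductive definition
   that applies F.  Given f in Cantor space, read as such a graph, call a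
   configuration grounded if f gives it the value that it should have in terms
   of the values of its immediate subcomputations, and the subcomputations
   found in this way form a well-founded tree.  The Suslin functional decides
   groundedness, and the value that f gives to a grounded configuration is
   always correct.

   If some configuration n is not grounded although all its immediate
   subcomputations are, then f is refuted at n: f either omits the correct value
   of n or contains another one.  Let G(f) be the least bound for such a
   disagreement, and 0 if there is none.  By SCF some g in Theta(G) agrees
   with X below G(g).  This g is not refuted, and hence, by induction on
   computations, exactly the terminating configurations are grounded for g.
   Thus {e}(F) terminates if and only if (e, F) is grounded for some element of
   Theta(G).

   Unbounded search is the only use of scheme S9. *)
Require Import Defs.
From mathcomp Require Import all_boot.
From mathcomp Require Import boolp.

Set Implicit Arguments.
Unset Strict Implicit.
Unset Printing Implicit Defensive.

(** * Reindexing arguments *)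

Definition types (Phi : seq object) : seq nat :=
  [seq ftype_code (tag x) | x <- Phi].

(** An index records the types of its arguments, so one index can serve all parameters only if these
    types are the same for all of them. *)
Definition uniform P (A : P -> seq object) : Prop :=
  exists l, forall p, types (A p) = l.

(* In a context [A] depending on a parameter [p], everything that the index [e]
   computes in the context [B p] is computed in [A p] by one index. *)
Definition reduces P (A B : P -> seq object) : Prop :=
  forall e, exists e', forall p a, computes e (B p) a -> computes e' (A p) a.

Lemma reduces_trans P (B A C : P -> seq object) :
  reduces A B -> reduces B C -> reduces A C.
Proof.
move=> AB BC e; have [e1 E1] := BC e; have [e2 E2] := AB e1.
by exists e2 => p a /E1/E2.
Qed.

Lemma reduces_refl P (A : P -> seq object) : reduces A A.
Proof. by move=> e; exists e. Qed.

Lemma reduces_move P (A B : P -> seq object) (y : P -> object) k :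
    uniform (fun p => A p ++ y p :: B p) -> (forall p, size (A p) = k) ->
  reduces (fun p => A p ++ y p :: B p) (fun p => y p :: A p ++ B p).
Proof.
move=> [l lP] kP e; exists (pack [:: 6; pack l; k; e]) => p a He.
by rewrite -(lP p) -(kP p); apply: S6.
Qed.

Lemma iter_rotr1 T (s1 s2 : seq T) :
  iter (size s2) (rotr 1) (s1 ++ s2) = s2 ++ s1.
Proof.
elim/last_ind: s2 s1 => [|s2 z IH] s1; first by rewrite cats0.
by rewrite size_rcons iterSr -rcons_cat rotr1_rcons -cat_cons IH cat_rcons.
Qed.

Lemma reduces_rotr P (L B : P -> seq object) k :
    uniform (fun p => L p ++ B p) -> (forall p, size (L p) = k.+1) ->
  reduces (fun p => L p ++ B p) (fun p => rotr 1 (L p) ++ B p).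
Proof.
move=> [l lP] kP e; exists (pack [:: 6; pack l; k; e]) => p a.
move: (lP p) (kP p); case/lastP: (L p) => // s z <-.
rewrite size_rcons rotr1_rcons cat_rcons => -[<-] He.
exact: S6.
Qed.

(** S6 only moves an argument to the front. For the opposite move, the block [y p :: A p] is rotated
    [k] times, each time by one S6 that brings its last entry to the front, until [y p] stands at
    its end. *)
Lemma reduces_insert P (A B : P -> seq object) (y : P -> object) k :
    uniform (fun p => y p :: A p ++ B p) -> (forall p, size (A p) = k) ->
  reduces (fun p => y p :: A p ++ B p) (fun p => A p ++ y p :: B p).
Proof.
move=> [l lP] kP.
have uni i : uniform (fun p => iter i (rotr 1) (y p :: A p) ++ B p).
  exists (iter i (rotr 1) (take k.+1 l) ++ drop k.+1 l) => p.
  have <- : types (y p :: A p) ++ types (B p) = l.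
    by rewrite /types -map_cat -(lP p).
  have sz : size (types (y p :: A p)) = k.+1 by rewrite size_map /= kP.
  rewrite -sz take_size_cat // drop_size_cat // /types map_cat; congr (_ ++ _).
  by elim: i => //= i <-; rewrite map_rotr.
have red i : reduces (fun p => (y p :: A p) ++ B p)
                     (fun p => iter i (rotr 1) (y p :: A p) ++ B p).
  elim: i => [|i IH]; first exact: reduces_refl.
  apply: reduces_trans IH _ => /=.
  apply: reduces_rotr (uni i) _ => p.
  by elim: i => /= [|i IHi]; rewrite ?size_rotr ?kP.
move=> e; have [e' He'] := red k e; exists e' => p a He; apply: He'.
by rewrite -cat1s -{1}(kP p) iter_rotr1 -catA.
Qed.

(** The extra number is discarded by a primitive recursion on it: the zero case runs [e], and the
    successor case [h] swaps its two leading arguments and returns the previous value by S3. *)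
Lemma reduces_drop P (A : P -> seq object) (n : P -> nat) :
  uniform A -> reduces (fun p => @obj ty0 (n p) :: A p) A.
Proof.
move=> [l lP] e.
have sA m p : signature (@obj ty0 m :: A p) = pack (ftype_code ty0 :: l).
  by rewrite -(lP p).
have s1 m b p : signature [:: @obj ty0 b, @obj ty0 m & A p]
    = pack [:: ftype_code ty0, ftype_code ty0 & l].
  by rewrite -(lP p).
pose h := pack [:: 6; pack [:: ftype_code ty0, ftype_code ty0 & l]; 1;
  pack [:: 3; pack [:: ftype_code ty0, ftype_code ty0 & l]]].
exists (pack [:: 5; pack (ftype_code ty0 :: l); e; h]) => p a He.
elim: (n p) => [|m IH].
  by rewrite -(sA 0 p); apply: S5_zero.
rewrite -(sA m.+1 p); apply: S5_succ; first by rewrite sA; exact: IH.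
rewrite /h -{1}(s1 a m p) -(s1 m a p).
apply: (@S6 _ (@obj ty0 a) [:: @obj ty0 m]).
exact: S3.
Qed.

Definition contains P (A : P -> seq object) s (phi : P -> interp s) : Prop :=
  exists k A1 A2, forall p,
    A p = A1 p ++ obj (phi p) :: A2 p /\ size (A1 p) = k.

(* The values of the variables form a parameter [p : P]; binding a variable
   extends the parameter by a component and [A p] by an argument.  Closure
   lemmas for [cmp] thus speak of Rocq functions of [p]. *)
Record ctx P := Ctx {
  cobj :> P -> seq object;
  _ : uniform cobj;
  _ : contains cobj (fun=> suslin : interp ty2)}.

Lemma ctx_uniform P (A : ctx P) : uniform A. Proof. by case: A. Qed.
Lemma ctx_suslin P (A : ctx P) : contains A (fun=> suslin : interp ty2).
Proof. by case: A. Qed.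

Lemma uniform_ext P (A : P -> seq object) s : uniform A ->
  uniform (fun q : interp s * P => obj q.1 :: A q.2).
Proof.
by case=> l lP; exists (ftype_code s :: l) => q /=; rewrite lP.
Qed.

Lemma contains_ext P (A : P -> seq object) s t (phi : P -> interp t) :
    contains A phi ->
  contains (fun q : interp s * P => obj q.1 :: A q.2) (fun q => phi q.2).
Proof.
move=> [k [A1 [A2 AP]]].
exists k.+1, (fun q => obj q.1 :: A1 q.2), (fun q => A2 q.2) => q /=.
by have [-> ->] := AP q.2.
Qed.

Lemma contains_ext0 P (A : P -> seq object) s :
  contains (fun q : interp s * P => obj q.1 :: A q.2) fst.
Proof. by exists 0, (fun=> [::]), (fun q => A q.2). Qed.

Definition exts s P (A : ctx P) : ctx (interp s * P) :=
  Ctx (uniform_ext s (ctx_uniform A)) (contains_ext s (ctx_suslin A)).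

Definition ext P (A : ctx P) : ctx (nat * P) := exts ty0 A.

(** * Computable functions and decidable relations *)

Definition cmp P (A : ctx P) (v : P -> nat) : Prop :=
  exists e, forall p, computes e (A p) (v p).

Lemma cmp_reduces P Q (A : ctx P) (B : ctx Q) (h : P -> Q) v :
  reduces A (B \o h) -> cmp B v -> cmp A (v \o h).
Proof.
move=> red [e eP]; have [e' e'P] := red e.
by exists e' => p; apply: e'P; exact: eP.
Qed.

Lemma cmp_ext P (A : ctx P) v w : (forall p, v p = w p) -> cmp A v -> cmp A w.
Proof. by move=> /funext ->. Qed.

Lemma cmp_contains P (A : ctx P) (n : P -> nat) :
    contains A (n : P -> interp ty0) ->
  cmp A n.
Proof.
move=> [k [A1 [A2 AP]]].
have [l lP] := ctx_uniform A.
have E p : A p = A1 p ++ @obj ty0 (n p) :: A2 p by have [->] := AP p.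
exists (pack [:: 6; pack l; k;
   pack [:: 3; pack (ftype_code ty0 :: take k l ++ drop k.+1 l)]]) => p.
rewrite -(lP p).
have -> : ftype_code ty0 :: take k (types (A p)) ++ drop k.+1 (types (A p)) =
          types (@obj ty0 (n p) :: A1 p ++ A2 p).
  have sz : size (types (A1 p)) = k by rewrite size_map; have [] := AP p.
  rewrite E /types /= !map_cat /= -!/(types _) -sz take_size_cat //.
  by rewrite -cat_rcons drop_size_cat // size_rcons.
rewrite E; have [_ <-] := AP p.
by apply: S6; apply: S3.
Qed.

Lemma cmp_fst P (A : ctx P) : cmp (ext A) fst.
Proof. exact: (@cmp_contains _ (ext A) fst (@contains_ext0 _ A ty0)). Qed.

Lemma cmp_wk P (A : ctx P) v : cmp A v -> cmp (ext A) (fun q => v q.2).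
Proof.
apply: (@cmp_reduces _ _ (ext A) A snd).
apply: reduces_drop.
by have [l lP] := ctx_uniform A; exists l => q; exact: lP.
Qed.

Lemma cmp_wk1 P (A : ctx P) v :
  cmp (ext A) v -> cmp (ext (ext A)) (fun q => v (q.1, q.2.2)).
Proof.
apply: (@cmp_reduces _ _ (ext (ext A)) (ext A) (fun q => (q.1, q.2.2))).
have := @reduces_move _ (fun q : nat * (nat * P) => [:: @obj ty0 q.1])
  (fun q => A q.2.2) (fun q => @obj ty0 q.2.1) 1 _ (fun=> erefl).
move/(_ (ctx_uniform (ext (ext A)))) => red.
apply: reduces_trans red _.
apply: (@reduces_drop _ (fun q : nat * (nat * P) => @obj ty0 q.1 :: A q.2.2)).
by have [l lP] := ctx_uniform (ext A); exists l => q; exact: (lP (q.1, q.2.2)).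
Qed.

Lemma cmp_const P (A : ctx P) n : cmp A (fun=> n).
Proof.
have [l lP] := ctx_uniform A.
by exists (pack [:: 2; pack l; n]) => p; rewrite -(lP p); exact: S2.
Qed.

Lemma cmp_comp P (A : ctx P) v w :
  cmp (ext A) v -> cmp A w -> cmp A (fun p => v (w p, p)).
Proof.
move=> [g gP] [h hP]; have [l lP] := ctx_uniform A.
exists (pack [:: 4; pack l; g; h]) => p; rewrite -(lP p).
exact: S4 (hP p) (gP (w p, p)).
Qed.

Lemma cmp_succ P (A : ctx P) v : cmp A v -> cmp A (fun p => (v p).+1).
Proof.
apply: (@cmp_comp _ A (fun q => q.1.+1)).
have [l lP] := ctx_uniform (ext A).
exists (pack [:: 1; pack l]) => q; rewrite -(lP q).
exact: S1.
Qed.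

Lemma cmp_rec P (A : ctx P) g (h : P -> nat -> nat -> nat) n :
    cmp A g -> cmp (ext (ext A)) (fun q => h q.2.2 q.1 q.2.1) -> cmp A n ->
  cmp A (fun p => nat_rect (fun=> nat) (g p) (h p) (n p)).
Proof.
move=> [e eP] [d dP].
apply: (@cmp_comp _ A
  (fun q => nat_rect (fun=> nat) (g q.2) (h q.2) q.1)).
have [l lP] := ctx_uniform (ext A).
have sig x p : pack l = signature (@obj ty0 x :: A p) by rewrite -(lP (x, p)).
exists (pack [:: 5; pack l; e; d]) => -[x p].
elim: x => [|x IH] /=; first by rewrite (sig 0 p); apply: S5_zero.
rewrite (sig x.+1 p); apply: S5_succ; first by rewrite -sig; exact: IH.
exact: (dP (x, (_, p))).
Qed.

Lemma reduces_push P (A : ctx P) w : cmp A w ->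
  reduces A (fun p => @obj ty0 (w p) :: A p).
Proof.
move=> [h hP] g; have [l lP] := ctx_uniform A.
exists (pack [:: 4; pack l; g; h]) => p a Hg; rewrite -(lP p).
exact: S4 (hP p) Hg.
Qed.

(* Kleene's self-application: the searching index [d] receives itself as its
   first argument [x] and continues the search by [{x}(x, n + 1, Phi)]. *)
Lemma cmp_search P (A : ctx P) (t : P -> nat -> nat) (v : P -> nat) :
    cmp (ext A) (fun q => t q.2 q.1) ->
    (forall p, t p (v p) = 0) -> (forall p n, n < v p -> t p n = 1) ->
  cmp A v.
Proof.
move=> ct t0 t1.
pose B : ctx (nat * (nat * P)) := ext (ext A).
have [l lP] := ctx_uniform B.
pose l3 := ftype_code ty0 :: l.
have [t' t'P] : cmp B (fun q => t q.2.2 q.2.1) by exact: cmp_wk ct.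
have [g gP] : cmp B (fun q => q.2.1) by apply: cmp_wk; exact: cmp_fst.
(* The continuation for the test value 1. S5 hands it the predecessor 0 and the value [b] of the
   zero case; it discards both, replaces [n] by [n.+1], and calls [x] on itself. *)
have [h hP] : exists h, forall x n b p a,
    computes x [:: @obj ty0 x, @obj ty0 n.+1 & A p] a ->
    computes h [:: @obj ty0 0, @obj ty0 b, @obj ty0 x, @obj ty0 n & A p] a.
  have [e eP] : exists e, forall x n p a,
      computes x [:: @obj ty0 x, @obj ty0 n & A p] a ->
      computes e [:: @obj ty0 x, @obj ty0 x, @obj ty0 n & A p] a.
    exists (pack [:: 9; pack l3; size l]) => x n p a Hx.
    have sz : size (B (x, (n, p))) = size l.
      by rewrite -(lP (x, (n, p))) size_map.
    rewrite /l3 -{1}(lP (x, (n, p))).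
    apply: (@S9 (size l) x (B (x, (n, p)))); first by rewrite sz.
    by rewrite -sz take_size.
  pose push := @reduces_push _ B (fun q => q.1) (cmp_fst _).
  have [e1 e1P] := push e.
  have uC : uniform (fun q : nat * (nat * P) =>
     [:: @obj ty0 q.2.1.+1, @obj ty0 q.1 & A q.2.2]).
    by exists l => q; rewrite -(lP (q.2.1.+1, (q.1, q.2.2))).
  have [e2 e2P] := @reduces_move _ (fun q : nat * (nat * P) =>
    [:: @obj ty0 q.2.1.+1]) (fun q => A q.2.2) (fun q => @obj ty0 q.1) 1
    uC (fun=> erefl) e1.
  have [e3 e3P] := @reduces_drop _ _ (fun q : nat * (nat * P) => q.2.1) uC e2.
  have [e4 e4P] := @reduces_move _ (fun q : nat * (nat * P) =>
    [:: @obj ty0 q.2.1.+1; @obj ty0 q.1]) (fun q => A q.2.2)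
    (fun q => @obj ty0 q.2.1) 2
    ltac:(by exists l3 => q; rewrite /l3 -(lP (q.1, q.2))) (fun=> erefl) e3.
  have [e5 e5P] := reduces_push (cmp_succ (cmp_wk (cmp_fst A)) : cmp B _) e4.
  have uB3 : uniform (fun q : nat * (nat * (nat * P)) => B q.2).
    by exists l => q; exact: lP.
  have [e7 e7P] := @reduces_drop _ _
    (fun q : nat * (nat * (nat * P)) => q.1) uB3 e5.
  have uB4 : uniform (fun q : nat * (nat * (nat * P)) => @obj ty0 q.1 :: B q.2).
    by exists l3 => q; rewrite /l3 -(lP q.2).
  have [e8 e8P] := @reduces_drop _ _ (fun=> 0) uB4 e7.
  exists e8 => x n b p a Hx.
  apply: (e8P (b, (x, (n, p)))); apply: (e7P (b, (x, (n, p)))).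
  apply: (e5P (x, (n, p))); apply: (e4P (x, (n, p))); apply: (e3P (x, (n, p))).
  apply: (e2P (x, (n, p))); apply: (e1P (x, (n.+1, p))); exact: eP.
(* By S4, [d] puts the test value [t p n] in front; S5 then branches on it, returning [n] through
   [g] at 0 and continuing through [h] at 1. *)
pose d := pack [:: 4; pack l; pack [:: 5; pack l3; g; h]; t'].
have dP p n b : t p n = b ->
    computes (pack [:: 5; pack l3; g; h])
      [:: @obj ty0 b, @obj ty0 d, @obj ty0 n & A p] (v p) ->
    computes d [:: @obj ty0 d, @obj ty0 n & A p] (v p).
  move=> <- Hb; rewrite {1}/d -{1}(lP (d, (n, p))).
  by apply: S4 Hb; exact: (t'P (d, (n, p))).
have sig b p n :
    pack l3 = signature [:: @obj ty0 b, @obj ty0 d, @obj ty0 n & A p].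
  by rewrite /l3 -(lP (d, (n, p))).
have gd p n : computes (pack [:: 5; pack l3; g; h])
      [:: @obj ty0 0, @obj ty0 d, @obj ty0 n & A p] n.
  by rewrite (sig 0 p n); apply: S5_zero; exact: (gP (d, (n, p))).
(* The induction is on the distance [k] from the current candidate to the zero [v p] of the test. *)
have run p k : k <= v p ->
    computes d [:: @obj ty0 d, @obj ty0 (v p - k) & A p] (v p).
  elim: k => [|k IH] le_kv; first by rewrite subn0; exact: dP (t0 p) (gd _ _).
  have lt_kv : v p - k.+1 < v p by rewrite ltn_subrL (leq_trans _ le_kv).
  apply: (dP _ _ _ (t1 _ _ lt_kv)).
  (* At 1, S5 also demands that the zero case be defined; its value is the candidate itself, which
     [h] ignores. *)
  rewrite (sig 1 p (v p - k.+1)); apply: S5_succ.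
    by rewrite -sig; exact: gd.
  by apply: hP; rewrite -subSn // subSS; exact: IH (ltnW le_kv).
have [e0 e0P] := reduces_push (cmp_const (ext A) d) d.
have [e1 e1P] := reduces_push (cmp_const A 0) e0.
exists e1 => p; apply: e1P; apply: (e0P (0, p)) => /=.
by rewrite -(subnn (v p)); exact: run.
Qed.

(** S8 applies only the first argument, and the functions fed to it are computed with that argument
    still in front. The abstract context [B] hides this rearrangement: whatever is computable in
    [A], with or without a further variable, remains so there. *)
Lemma cmp_S8 P (A : ctx P) s t (phi : P -> interp (TArr s t)) v :
    contains A phi ->
    (forall B : P -> seq object, reduces B A ->
      (forall u, reduces (fun q : interp u * P => obj q.1 :: B q.2)
                         (exts u A)) ->
      exists ds, forall p, applies (B p) ds (phi p) (v p)) ->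
  cmp A v.
Proof.
move=> [k [A1 [A2 AP]]] H.
have eqA p : A p = A1 p ++ obj (phi p) :: A2 p by have [->] := AP p.
have szA p : size (A1 p) = k by have [] := AP p.
have [l lP] := ctx_uniform A.
have sz p : size (types (A1 p)) = k by rewrite size_map.
pose l' := ftype_code (TArr s t) :: take k l ++ drop k.+1 l.
pose B p := obj (phi p) :: A1 p ++ A2 p.
have lB p : types (B p) = l'.
  rewrite /l' -(lP p) eqA /types map_cat -!/(types _) -(sz p) take_size_cat //.
  by rewrite -cat_rcons drop_size_cat ?size_rcons // /B /types /= map_cat.
have redB : reduces B A.
  have -> : (A : P -> seq object) = fun p => A1 p ++ obj (phi p) :: A2 p.
    exact/funext.
  by apply: reduces_insert szA; exists l'.
have redBu u : reduces (fun q : interp u * P => obj q.1 :: B q.2) (exts u A).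
  have -> : (exts u A : interp u * P -> seq object) =
      fun q => (obj q.1 :: A1 q.2) ++ obj (phi q.2) :: A2 q.2.
    by apply/funext => q /=; rewrite eqA.
  have -> : (fun q : interp u * P => obj q.1 :: B q.2) =
      fun q => [:: obj q.1] ++ obj (phi q.2) :: (A1 q.2 ++ A2 q.2) by [].
  have red := @reduces_move _ (fun q : interp u * P => [:: obj q.1])
     (fun q => A1 q.2 ++ A2 q.2) (fun q => obj (phi q.2)) 1 _ (fun=> erefl).
  apply: reduces_trans (red _) _.
    by exists (ftype_code u :: l') => q; rewrite -(lB q.2).
  apply: (@reduces_insert _ (fun q : interp u * P => obj q.1 :: A1 q.2)
    (fun q => A2 q.2) (fun q => obj (phi q.2)) k.+1); last first.
    by move=> q /=; rewrite szA.
  exists (ftype_code (TArr s t) :: ftype_code u :: take k l ++ drop k.+1 l) => q.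
  by have := lB q.2; rewrite /l' /B /= => -[->].
have [ds dsP] := H B redB redBu.
have [e eP] := @reduces_move _ A1 A2 (fun p => obj (phi p)) k
  ltac:(by exists l => p; rewrite -eqA) szA (pack [:: 8, pack l' & ds]).
exists e => p; rewrite eqA; apply: eP.
by rewrite -(lB p); apply: S8; exact: dsP.
Qed.

Lemma cmp_app1 P (A : ctx P) (f : P -> nat -> nat) t :
  contains A (f : P -> interp ty1) -> cmp A t -> cmp A (fun p => f p (t p)).
Proof.
move=> hf [d dP]; apply: (cmp_S8 hf) => B /(_ d) [d' red] _.
exists [:: d'] => p; apply: (@applies_cons _ _ _ ty0 ty0 _ (t p)).
  by move=> xi; exact: red (dP p).
exact: applies_nil.
Qed.

Lemma cmp_app2 P (A : ctx P) (F : P -> (nat -> nat) -> nat) t :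
    contains A (F : P -> interp ty2) -> cmp (ext A) (fun q => t q.2 q.1) ->
  cmp A (fun p => F p (t p)).
Proof.
move=> hF [d dP]; apply: (cmp_S8 hF) => B _ /(_ ty0 d) [d' red].
exists [:: d'] => p; apply: (@applies_cons _ _ _ ty1 ty0 _ (t p)).
  by case=> x []; exact: (red (x, p)) (dP (x, p)).
exact: applies_nil.
Qed.

Lemma cmp_app3 P (A : ctx P)
    (T : P -> ((nat -> nat) -> nat) -> nat -> (nat -> nat)) G i j :
    contains A (T : P -> interp (TArr ty2 (TArr ty0 ty1))) ->
    cmp (exts ty1 A) (fun q => G q.2 q.1) -> cmp A i -> cmp A j ->
  cmp A (fun p => T p (G p) (i p) (j p)).
Proof.
move=> hT [d dP] [e eP] [h hP].
have {}hT :
    contains A (T : P -> interp (TArr ty2 (TArr ty0 (TArr ty0 ty0)))) by [].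
apply: (cmp_S8 hT) => B red /(_ ty1 d) [d' redd].
have [e' rede] := red e; have [h' redh] := red h.
exists [:: d'; e'; h'] => p.
apply: (@applies_cons _ _ _ ty2 _ _ (G p)).
  by case=> x []; exact: (redd (x, p)) (dP (x, p)).
apply: (@applies_cons _ _ _ ty0 _ _ (i p)).
  by move=> xi; exact: rede (eP p).
apply: (@applies_cons _ _ _ ty0 ty0 _ (j p)).
  by move=> xi; exact: redh (hP p).
exact: applies_nil.
Qed.

(* Truth is coded by 0, as in the functional [suslin]. *)
Definition truth (R : Prop) : nat := if `[< R >] then 0 else 1.

Definition dec P (A : ctx P) (R : P -> Prop) : Prop :=
  cmp A (fun p => truth (R p)).

Lemma truth_true (R : Prop) : R -> truth R = 0.
Proof. by move=> r; rewrite /truth asboolT. Qed.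

Lemma truth_false (R : Prop) : ~ R -> truth R = 1.
Proof. by move=> r; rewrite /truth asboolF. Qed.

Lemma truth0 (R : Prop) : truth R = 0 <-> R.
Proof.
by case: (EM R) => r; [rewrite truth_true | rewrite truth_false].
Qed.

Lemma dec_ext P (A : ctx P) R R' : (forall p, R p <-> R' p) ->
  dec A R -> dec A R'.
Proof. by move=> RR'; apply: cmp_ext => p; rewrite (propext (RR' p)). Qed.

Lemma dec_wk P (A : ctx P) R : dec A R -> dec (ext A) (fun q => R q.2).
Proof. exact: cmp_wk. Qed.

Lemma cmp_zero_case P (A : ctx P) n u v : cmp A n -> cmp A u -> cmp A v ->
  cmp A (fun p => if n p == 0 then u p else v p).
Proof.
move=> cn cu cv.
have := @cmp_rec _ A _ (fun p _ _ => v p) _ cu (cmp_wk (cmp_wk cv)) cn.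
by apply: cmp_ext => p; case: (n p).
Qed.

Lemma dec_zero P (A : ctx P) n : cmp A n -> dec A (fun p => n p = 0).
Proof.
move=> cn; apply: cmp_ext (cmp_zero_case cn (cmp_const A 0) (cmp_const A 1)).
by move=> p; case: eqP => [/truth_true|/truth_false].
Qed.

Lemma cmp_if P (A : ctx P) (b : P -> bool) u v :
    dec A b -> cmp A u -> cmp A v ->
  cmp A (fun p => if b p then u p else v p).
Proof.
move=> db cu cv; apply: cmp_ext (cmp_zero_case db cu cv) => p.
by case: (b p); [rewrite truth_true | rewrite truth_false].
Qed.

Lemma dec_not P (A : ctx P) R : dec A R -> dec A (fun p => ~ R p).
Proof.
move=> dR.
apply: cmp_ext (cmp_zero_case dR (cmp_const A 1) (cmp_const A 0)) => p.
case: (EM (R p)) => r; first by rewrite truth_true //= truth_false.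
by rewrite truth_false //= truth_true.
Qed.

Lemma dec_and P (A : ctx P) R R' : dec A R -> dec A R' ->
  dec A (fun p => R p /\ R' p).
Proof.
move=> dR dR'; apply: cmp_ext (cmp_zero_case dR dR' (cmp_const A 1)) => p.
case: (EM (R p)) => r; rewrite ?(truth_true r) ?(truth_false r) /=; last first.
  by rewrite truth_false // => -[].
by congr truth; apply/propext; split=> [|[]].
Qed.

Lemma dec_or P (A : ctx P) R R' : dec A R -> dec A R' ->
  dec A (fun p => R p \/ R' p).
Proof.
move=> /dec_not dR /dec_not dR'; apply: dec_ext (dec_not (dec_and dR dR')) => p.
split=> [nn|r [] //]; last by case: r.
by apply: contrapT => n; apply: nn; split=> r; apply: n; [left | right].
Qed.

Lemma dec_imp P (A : ctx P) R R' : dec A R -> dec A R' ->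
  dec A (fun p => R p -> R' p).
Proof.
move=> /dec_not dR dR'; apply: dec_ext (dec_or dR dR') => p.
split=> [[]//|rr']; case: (EM (R p)) => [/rr'|]; [by right|by left].
Qed.

Lemma dec_andb P (A : ctx P) (a b : P -> bool) : dec A a -> dec A b ->
  dec A (fun p => a p && b p).
Proof.
by move=> da db; apply: dec_ext (dec_and da db) => p; split=> /andP.
Qed.

(** ** Arithmetic operations *)

Lemma cmp_pred P (A : ctx P) v : cmp A v -> cmp A (fun p => (v p).-1).
Proof.
move=> cv; have := @cmp_rec _ A _ (fun _ x _ => x) _ (cmp_const A 0)
  (cmp_fst _) cv.
by apply: cmp_ext => p; case: (v p).
Qed.

Lemma cmp_add P (A : ctx P) u v : cmp A u -> cmp A v ->
  cmp A (fun p => u p + v p).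
Proof.
move=> cu cv; have := @cmp_rec _ A _ (fun _ _ b => b.+1) _ cu
  (cmp_succ (cmp_wk (cmp_fst _))) cv.
by apply: cmp_ext => p; elim: (v p) => [|n /= ->]; rewrite ?addn0 ?addnS.
Qed.

Lemma cmp_sub P (A : ctx P) u v : cmp A u -> cmp A v ->
  cmp A (fun p => u p - v p).
Proof.
move=> cu cv; have := @cmp_rec _ A _ (fun _ _ b => b.-1) _ cu
  (cmp_pred (cmp_wk (cmp_fst _))) cv.
by apply: cmp_ext => p; elim: (v p) => [|n /= ->]; rewrite ?subn0 ?subnS.
Qed.

Lemma cmp_mul P (A : ctx P) u v : cmp A u -> cmp A v ->
  cmp A (fun p => u p * v p).
Proof.
move=> cu cv; have := @cmp_rec _ A _ (fun p _ b => u p + b) _ (cmp_const A 0)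
  (cmp_add (cmp_wk (cmp_wk cu)) (cmp_wk (cmp_fst _))) cv.
by apply: cmp_ext => p; elim: (v p) => [|n /= ->]; rewrite ?muln0 ?mulnS.
Qed.

Lemma cmp_exp2 P (A : ctx P) v : cmp A v -> cmp A (fun p => 2 ^ v p).
Proof.
move=> cv; have := @cmp_rec _ A _ (fun _ _ b => 2 * b) _ (cmp_const A 1)
  (cmp_mul (cmp_const _ 2) (cmp_wk (cmp_fst _))) cv.
by apply: cmp_ext => p; elim: (v p) => [|n /= ->]; rewrite ?expn0 ?expnS.
Qed.

Lemma dec_le P (A : ctx P) u v : cmp A u -> cmp A v ->
  dec A (fun p => u p <= v p).
Proof.
by move=> cu cv; apply: dec_ext (dec_zero (cmp_sub cu cv)) => p; split=> /eqP.
Qed.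

Lemma dec_eq P (A : ctx P) u v : cmp A u -> cmp A v ->
  dec A (fun p => u p = v p).
Proof.
move=> cu cv; apply: dec_ext (dec_and (dec_le cu cv) (dec_le cv cu)) => p.
by split=> [[le_uv le_vu]|->//]; apply/eqP; rewrite eqn_leq le_uv.
Qed.

Lemma dec_eqb P (A : ctx P) u v : cmp A u -> cmp A v ->
  dec A (fun p => u p == v p).
Proof.
by move=> cu cv; apply: dec_ext (dec_eq cu cv) => p; split=> /eqP.
Qed.

(** As truth is 0, a bounded disjunction is a product of truth values. *)
Lemma dec_bex P (A : ctx P) (R : P -> nat -> Prop) b :
    dec (ext A) (fun q => R q.2 q.1) -> cmp A b ->
  dec A (fun p => exists2 n, n < b p & R p n).
Proof.
move=> dR cb; have dR2 := cmp_wk1 dR.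
have := @cmp_rec _ A _ (fun p x b => b * truth (R p x)) _ (cmp_const A 1)
  (cmp_mul (cmp_wk (cmp_fst _)) dR2) cb.
apply: cmp_ext => p; elim: (b p) => [|n /= ->].
  by rewrite truth_false // => -[].
case: (EM (R p n)) => r.
  by rewrite (truth_true r) muln0 truth_true //; exists n.
rewrite (truth_false r) muln1; congr truth; apply/propext; split=> -[m].
  by move=> lt_mn Rm; exists m => //; exact: ltnW.
rewrite ltnS leq_eqVlt => /predU1P [->//|lt_mn Rm]; by exists m.
Qed.

(** ** Quantifiers *)

Lemma dec_suslin P (A : ctx P) (R : P -> nat -> Prop) :
    dec (ext A) (fun q => R q.2 q.1) ->
  dec A (fun p => exists g : nat -> nat, forall n, R p (pack (mkseq g n))).
Proof.
move=> dR; have := @cmp_app2 _ A _ (fun p n => truth (R p n)) (ctx_suslin A) dR.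
apply: cmp_ext => p; congr truth.
by apply/propext; split=> -[g gP]; exists g => n; move: (gP n); rewrite truth0.
Qed.

Lemma pack_cons x s : pack (x :: s) = 2 ^ x * (pack s).*2.+1.
Proof. by []. Qed.

Lemma packK : cancel pack CodeSeq.decode. Proof. exact: CodeSeq.codeK. Qed.
Lemma unpackK : cancel CodeSeq.decode pack. Proof. exact: CodeSeq.decodeK. Qed.
Lemma pack_inj : injective pack. Proof. exact: can_inj packK. Qed.

(* A number quantifier is a Suslin quantifier over the head of a sequence. *)
Lemma dec_ex P (A : ctx P) (R : P -> nat -> Prop) :
    dec (ext A) (fun q => R q.2 q.1) ->
  dec A (fun p => exists n, R p n).
Proof.
move=> dR.
(* [c] codes the empty sequence or a sequence whose head [m] satisfies [R p]; the number
   [2 ^ m * k.*2.+1] codes [m] followed by the sequence with code [k]. Both [m] and [k] lie below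
   [c], so bounded quantifiers suffice. *)
pose Q (p : P) c := c = 0 \/ exists2 m, m < c &
  exists2 k, k < c & c = 2 ^ m * k.*2.+1 /\ R p m.
have dQ : dec (ext A) (fun q => Q q.2 q.1).
  apply: dec_or; first by apply: dec_zero; exact: cmp_fst.
  apply: (@dec_bex _ _ (fun q m => exists2 k, k < q.1 &
    q.1 = 2 ^ m * k.*2.+1 /\ R q.2 m)); last exact: cmp_fst.
  apply: (@dec_bex _ _ (fun q k => q.2.1 = 2 ^ q.1 * k.*2.+1 /\ R q.2.2 q.1));
    last by apply: cmp_wk; exact: cmp_fst.
  have c1 := cmp_wk (cmp_fst (ext A)); have c2 := cmp_wk (cmp_wk (cmp_fst A)).
  apply: dec_and; last exact: (cmp_wk (cmp_wk1 dR)).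
  apply: dec_eq c2 (cmp_mul (cmp_exp2 c1) _).
  apply: cmp_succ; apply: cmp_ext (cmp_add (cmp_fst _) (cmp_fst _)) => q.
  by rewrite addnn.
apply: dec_ext (dec_suslin dQ) => p; split=> [[g /(_ 1)]|[m Rm]].
  case=> [/(@pack_inj [:: g 0] [::])//|[m _ [k _ [_ Rm]]]].
  by exists m.
exists (fun=> m) => -[|n]; first by left.
have -> : mkseq (fun=> m) n.+1 = m :: mkseq (fun=> m) n.
  by rewrite /mkseq /= (iotaDl 1) -map_comp.
right; rewrite pack_cons; set k := pack _.
have lt_k : k < 2 ^ m * k.*2.+1.
  by rewrite (leq_trans _ (leq_pmull _ _)) ?expn_gt0 // ltnS -addnn leq_addr.
exists m; last by exists k.
by rewrite (leq_trans (ltn_expl m (isT : 1 < 2))) // leq_pmulr.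
Qed.

Lemma dec_all P (A : ctx P) (R : P -> nat -> Prop) :
    dec (ext A) (fun q => R q.2 q.1) ->
  dec A (fun p => forall n, R p n).
Proof.
move=> /dec_not/(dec_ex (R := fun p n => ~ R p n))/dec_not; apply: dec_ext => p.
by split=> [/forallNP nn n|nn [n]]; [exact: contrapT | apply].
Qed.

(** ** Least witnesses *)

Lemma least_ex (Q : nat -> Prop) : exists n, (exists m, Q m) ->
  Q n /\ forall m, m < n -> ~ Q m.
Proof.
have [[m Qm]|nQ] := EM (exists m, Q m); last by exists 0 => /nQ.
have ex : exists m, `[< Q m >] by exists m; exact/asboolP.
case: (ex_minnP ex) => n /asboolP Qn min; exists n => _; split=> // k lt_kn.
by move/asboolP/min; rewrite leqNgt lt_kn.
Qed.

Definition least (Q : nat -> Prop) : nat :=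
  if pselect (exists m, Q m) then sval (cid (least_ex Q)) else 0.

Lemma leastP (Q : nat -> Prop) m : Q m -> Q (least Q).
Proof.
move=> Qm; rewrite /least; case: pselect => [exQ|]; last by case; exists m.
by case: cid => n /= /(_ exQ) [].
Qed.

Lemma least_min (Q : nat -> Prop) m : m < least Q -> ~ Q m.
Proof.
rewrite /least; case: pselect => // exQ.
by case: cid => n /= /(_ exQ) [_]; apply.
Qed.

Lemma least_none (Q : nat -> Prop) : ~ (exists m, Q m) -> least Q = 0.
Proof. by rewrite /least; case: pselect. Qed.

(** The existence of a witness is decided first, through the Suslin functional. If there is none,
    the test succeeds at 0, the default value of [least], so the search always ends. *)
Lemma cmp_least P (A : ctx P) (Q : P -> nat -> Prop) :
  dec (ext A) (fun q => Q q.2 q.1) -> cmp A (fun p => least (Q p)).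
Proof.
move=> dQ.
have dN : dec (ext A) (fun q => ~ exists m, Q q.2 m).
  exact: dec_wk (dec_not (dec_ex dQ)).
apply: (cmp_search (t := fun p n => truth (Q p n \/ ~ exists m, Q p m))).
- exact: dec_or dQ dN.
- move=> p; apply: truth_true; have [[m]|] := EM (exists m, Q p m).
    by move/leastP; left.
  by right.
- move=> p n lt_n; apply: truth_false => -[|/least_none E].
    exact: least_min.
  by rewrite E in lt_n.
Qed.

(** The value is found by searching the graph. Functions on coded sequences can thus be given by
    decidable conditions with number quantifiers instead of recursions on codes. *)
Lemma cmp_graph P (A : ctx P) v :
  dec (ext A) (fun q => v q.2 = q.1) -> cmp A v.
Proof.
move=> /(@cmp_least _ _ (fun p n => v p = n)); apply: cmp_ext => p.
by rewrite -(leastP (erefl (v p))).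
Qed.

(** ** Coded sequences *)

#[local] Arguments pack : simpl never.
Local Notation unpack := CodeSeq.decode.

Lemma pack0 s : pack s = 0 <-> s = [::].
Proof. by split=> [/(@pack_inj s [::])|->]. Qed.

Lemma dec_pack_cons P (A : ctx P) u x m : cmp A u -> cmp A x -> cmp A m ->
  dec A (fun p => u p = pack (x p :: unpack (m p))).
Proof.
move=> cu cx cm; apply: dec_eq cu _.
apply: cmp_ext (cmp_mul (cmp_exp2 cx) (cmp_succ (cmp_add cm cm))) => p.
by rewrite pack_cons unpackK addnn.
Qed.

Lemma cmp_pack_cons P (A : ctx P) x s : cmp A x ->
  cmp A (fun p => pack (s p)) -> cmp A (fun p => pack (x p :: s p)).
Proof.
move=> cx cs.
apply: cmp_ext (cmp_mul (cmp_exp2 cx) (cmp_succ (cmp_add cs cs))) => p.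
by rewrite pack_cons addnn.
Qed.

Lemma cmp_unpack P (A : ctx P) v : cmp A v ->
  cmp A (fun p => pack (unpack (v p))).
Proof. by apply: cmp_ext => p; rewrite unpackK. Qed.

(** Setting the newest variable to 0 type-checks only if the function or relation does not depend on
    it. *)
Ltac weaken :=
  match goal with
  | |- @cmp _ (@ext ?P ?A) ?v =>
      refine (@cmp_wk P A (fun p => v (0, p)) _); cbn [fst snd]
  | |- @dec _ (@ext ?P ?A) ?v =>
      refine (@dec_wk P A (fun p => v (0, p)) _); cbn [fst snd]
  end.

Ltac computability :=
  repeat (cbv beta; first
    [ assumption | exact: cmp_fst | apply: cmp_const
    | apply: dec_and | apply: dec_or | apply: dec_ex
    | apply: dec_pack_cons | apply: dec_eq | apply: cmp_pack_cons | weaken ]).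

Lemma cmp_head P (A : ctx P) s : cmp A (fun p => pack (s p)) ->
  cmp A (fun p => head 0 (s p)).
Proof.
move=> cs; apply: cmp_graph; apply: (dec_ext (R := fun q =>
  (pack (s q.2) = 0 /\ q.1 = 0) \/
  exists m, pack (s q.2) = pack (q.1 :: unpack m))); last computability.
move=> [x p] /=; rewrite pack0; split.
  by case=> [[-> ->]|[m /pack_inj ->]].
by case: (s p) => [|y t] <-; [left | right; exists (pack t); rewrite packK].
Qed.

Lemma cmp_behead P (A : ctx P) s : cmp A (fun p => pack (s p)) ->
  cmp A (fun p => pack (behead (s p))).
Proof.
move=> cs; apply: cmp_graph; apply: (dec_ext (R := fun q =>
  (pack (s q.2) = 0 /\ q.1 = 0) \/
  exists x, pack (s q.2) = pack (x :: unpack q.1))); last computability.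
move=> [x p] /=; rewrite pack0; split.
  by case=> [[-> ->]|[m /pack_inj ->]] //=; rewrite unpackK.
by case: (s p) => [|y t] <-; [left | right; exists y; rewrite packK].
Qed.

Lemma cmp_drop P (A : ctx P) s i : cmp A (fun p => pack (s p)) -> cmp A i ->
  cmp A (fun p => pack (drop (i p) (s p))).
Proof.
move=> cs ci.
have := @cmp_rec _ A _ (fun _ _ b => pack (behead (unpack b))) _ cs _ ci.
move/(_ (cmp_behead (cmp_unpack (cmp_wk (cmp_fst _))))).
apply: cmp_ext => p; elim: (i p) => [|n /= ->]; first by rewrite drop0.
by rewrite packK -addn1 addnC -drop_drop drop1.
Qed.

Lemma cmp_nth P (A : ctx P) s i : cmp A (fun p => pack (s p)) -> cmp A i ->
  cmp A (fun p => nth 0 (s p) (i p)).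
Proof.
move=> cs ci; apply: cmp_ext (cmp_head (cmp_drop cs ci)) => p.
by rewrite -nth0 nth_drop addn0.
Qed.

Lemma cmp_size P (A : ctx P) s : cmp A (fun p => pack (s p)) ->
  cmp A (fun p => size (s p)).
Proof.
move=> cs; apply: cmp_ext (cmp_least (Q := fun p m => size (s p) <= m) _).
  move=> p; apply/eqP; rewrite eqn_leq.
  rewrite (leastP (Q := leq (size (s p))) (leqnn _)) andbT.
  by rewrite leqNgt; apply/negP => /least_min.
apply: dec_ext (dec_zero (cmp_drop (cmp_wk cs) (cmp_fst A))) => q.
rewrite pack0; split=> [E|]; last exact: drop_oversize.
by rewrite -subn_eq0 -size_drop E.
Qed.

(** The code is searched for as the only number whose decoding has the right length and entries, so
    the operations below need only be described entrywise. *)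
Lemma cmp_pack_nth P (A : ctx P) s : cmp A (fun p => size (s p)) ->
    cmp (ext A) (fun q => nth 0 (s q.2) q.1) ->
  cmp A (fun p => pack (s p)).
Proof.
move=> csz cnth; apply: cmp_graph.
have cu := cmp_unpack (cmp_fst A).
have := dec_and (dec_eq (cmp_size cu) (cmp_wk csz)) (dec_all
  (R := fun q i => nth 0 (unpack q.1) i = nth 0 (s q.2) i)
  (dec_eq (cmp_nth (cmp_wk cu) (cmp_fst _)) (cmp_wk1 cnth))).
apply: (dec_ext (A := ext A)) => -[c p] /=; split=> [[sz_eq nth_eq]|<-].
  rewrite -[c in RHS]unpackK; congr pack.
  by apply: (@eq_from_nth _ 0) => // i _; rewrite nth_eq.
by rewrite packK.
Qed.

Lemma cmp_take P (A : ctx P) s i : cmp A (fun p => pack (s p)) -> cmp A i ->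
  cmp A (fun p => pack (take (i p) (s p))).
Proof.
move=> cs ci; have csz := cmp_size cs; apply: cmp_pack_nth.
  have := cmp_if (dec_le ci csz) ci csz; apply: cmp_ext => p.
  by rewrite size_take_min minnC /minn leqNgt; case: ltnP.
have := cmp_if (dec_le (cmp_succ (cmp_fst A)) (cmp_wk ci))
  (cmp_nth (cmp_wk cs) (cmp_fst A)) (cmp_const _ 0).
apply: (cmp_ext (A := ext A)) => -[j p] /=; case: ltnP => [lt_ji|le_ij].
  by rewrite nth_take.
by rewrite nth_default // (leq_trans _ le_ij) // size_take_min geq_minl.
Qed.

Lemma cmp_cat P (A : ctx P) s t :
    cmp A (fun p => pack (s p)) -> cmp A (fun p => pack (t p)) ->
  cmp A (fun p => pack (s p ++ t p)).
Proof.
move=> cs ct; apply: cmp_pack_nth.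
  by apply: cmp_ext (cmp_add (cmp_size cs) (cmp_size ct)) => p;
    rewrite size_cat.
have csz := cmp_size (cmp_wk cs); have c1 := cmp_fst A.
have := cmp_if (dec_le (cmp_succ c1) csz) (cmp_nth (cmp_wk cs) c1)
  (cmp_nth (cmp_wk ct) (cmp_sub c1 csz)).
by apply: (cmp_ext (A := ext A)) => -[j p]; rewrite nth_cat.
Qed.

(** * Computations relative to a functional of type 2 *)

(* A list of arguments consisting of [F] and of numbers is represented by a
   list of numbers, with 0 for [F] and [x + 1] for the number [x]. *)
Definition objects (F : interp ty2) (Ph : seq nat) : seq object :=
  [seq if x is y.+1 then @obj ty0 y else obj F | x <- Ph].

Definition sig (Ph : seq nat) : nat :=
  pack [seq if x == 0 then ftype_code ty2 else ftype_code ty0 | x <- Ph].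

Lemma signature_objects F Ph : signature (objects F Ph) = sig Ph.
Proof.
by rewrite /signature /sig /objects -map_comp; congr pack; apply: eq_map; case.
Qed.

Definition config (e : nat) (Ph : seq nat) : nat := pack (e :: Ph).

(* The kinds of steps: 0 returns [arg]; 1 evaluates the configuration [arg]
   to some [b] and then the configuration [branch b]; 2 evaluates [branch x] for
   all [x] and applies [F] to the results; 3 is undefined. *)
Record step := Step { kind : nat; arg : nat; branch : nat -> nat }.

Definition ret a := Step 0 a id.
Definition seq2 m1 m2 := Step 1 m1 m2.
Definition tail_call m := Step 1 m (fun=> m).

(** The scheme is recognized by rebuilding the index from its own entries [g], [h] and the actual
    signature. Numbers are shifted by one, whence [ret x] for the successor in S1 and [x == 1] for
    the zero case of S5. The head of an empty list is 0 as well, so S8 also asks for a nonempty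
    list. S7 has no clause, since no argument has type 1. *)
Definition step_of (e : nat) (Ph : seq nat) : step :=
  let ix := unpack e in
  let g := nth 0 ix 2 in let h := nth 0 ix 3 in
  let x := head 0 Ph in let t := behead Ph in
  if (e == pack [:: 1; sig Ph]) && (0 < x) then ret x else
  if e == pack [:: 2; sig Ph; g] then ret g else
  if (e == pack [:: 3; sig Ph]) && (0 < x) then ret x.-1 else
  if e == pack [:: 4; sig Ph; g; h] then
    seq2 (config h Ph) (fun b => config g (b.+1 :: Ph)) else
  if (e == pack [:: 5; sig Ph; g; h]) && (x == 1) then
    tail_call (config g t) else
  if (e == pack [:: 5; sig Ph; g; h]) && (1 < x) then
    seq2 (config e (x.-1 :: t)) (fun b => config h [:: x.-1, b.+1 & t]) else
  if (e == pack [:: 6; sig Ph; g; h]) && (g < size Ph) then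
    tail_call (config h (nth 0 Ph g :: take g Ph ++ drop g.+1 Ph)) else
  if (e == pack [:: 8; sig Ph; g]) && (x == 0) && (0 < size Ph) then
    Step 2 0 (fun y => config g (y.+1 :: Ph)) else
  if (e == pack [:: 9; sig Ph; g]) && (0 < x) && (g <= size t) then
    tail_call (config x.-1 (take g t)) else
  Step 3 0 id.

Definition step_at (n : nat) : step :=
  step_of (head 0 (unpack n)) (behead (unpack n)).

(** In kind 1 the second subcomputation depends on the value of the first, hence the argument [v].
    An undefined configuration needs itself, which keeps it out of every well-founded
    computation. *)
Definition need (v : nat -> nat) (n m : nat) : Prop :=
  let s := step_at n in
  (kind s = 1 /\ (m = arg s \/ m = branch s (v (arg s)))) \/
  (kind s = 2 /\ exists x, m = branch s x) \/
  (kind s = 3 /\ m = n).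

Definition res (F : interp ty2) (v : nat -> nat) (n : nat) : nat :=
  let s := step_at n in
  if kind s == 0 then arg s else
  if kind s == 1 then v (branch s (v (arg s))) else
  if kind s == 2 then F (fun x => v (branch s x)) else 0.

(** [v] is total, but only its values at the needed configurations are constrained, and by
    [res_local] only these affect the result. *)
Inductive evals (F : interp ty2) : nat -> nat -> Prop :=
| Evals n v : (forall m, need v n m -> evals F m (v m)) ->
    evals F n (res F v n).

Lemma need_arg v n : kind (step_at n) = 1 -> need v n (arg (step_at n)).
Proof. by left; split=> //; left. Qed.

Lemma need_local v w n m :
    (kind (step_at n) = 1 -> v (arg (step_at n)) = w (arg (step_at n))) ->
  need v n m -> need w n m.
Proof.
by move=> E [[k1 H]|H]; [left; split=> //; rewrite -E | right].
Qed.

Lemma res_local F v w n :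
  (forall m, need v n m -> v m = w m) -> res F v n = res F w n.
Proof.
rewrite /res => eq_vw; case: eqP => // _; case: eqP => [k1|_].
  rewrite -(eq_vw _ (need_arg v k1)) eq_vw //.
  by left; split=> //; right.
case: eqP => // k2; congr F; apply/funext => x; apply: eq_vw.
by right; left; split=> //; exists x.
Qed.

Lemma evals_inv F n a : evals F n a ->
  exists2 v, (forall m, need v n m -> evals F m (v m)) & a = res F v n.
Proof. by case=> {a}n v; exists v. Qed.

Lemma evals_fun F n a b : evals F n a -> evals F n b -> a = b.
Proof.
move=> Ha; elim: Ha b => {a}n v _ IH b /evals_inv [w Hw ->].
apply: res_local => m vm; apply: (IH _ vm); apply: (Hw).
(* The two computations need the same configurations once they agree on the first subcomputation, so
   that agreement comes first. *)
apply: need_local vm => k1; apply: (IH); first exact: need_arg.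
exact/Hw/need_arg.
Qed.

Lemma evals_defined F n a : evals F n a -> kind (step_at n) <> 3.
Proof.
elim=> {a}n v _ IH k3; apply: (IH n _ k3).
by right; right.
Qed.

Lemma evals_computes F n a : evals F n a ->
  computes (head 0 (unpack n)) (objects F (behead (unpack n))) a.
Proof.
elim=> {a}n v /Evals/evals_defined; rewrite /need /res /step_at.
set e := head 0 _; set Ph := behead _; clearbody e Ph.
have hc e' Ph' : head 0 (unpack (config e' Ph')) = e' by rewrite packK.
have bc e' Ph' : behead (unpack (config e' Ph')) = Ph' by rewrite packK.
rewrite /step_of; set ix := unpack e.
move: (nth 0 ix 2) (nth 0 ix 3) => g h.
case: ifP => [/andP[/eqP-> x_gt0] _ _ /=|_].
  case: Ph x_gt0 => [|[|x] Ph] //= _.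
  by rewrite -(signature_objects F); apply: S1.
case: ifP => [/eqP-> _ _ /=|_].
  by rewrite -(signature_objects F); apply: S2.
case: ifP => [/andP[/eqP-> x_gt0] _ _ /=|_].
  case: Ph x_gt0 => [|[|x] Ph] //= _.
  by rewrite -(signature_objects F); apply: S3.
case: ifP => [/eqP-> _ /= IH|_].
  rewrite -(signature_objects F).
  have := IH (config h Ph); rewrite hc bc => IHh.
  have := IH (config g ((v (config h Ph)).+1 :: Ph)); rewrite hc bc => IHg.
  apply: (S4 (IHh _) (IHg _)); left; split=> //; [by left | by right].
case: ifP => [/andP[/eqP-> x1] _ /= IH|_].
  case: Ph x1 IH => [|[|[|x]] Ph] //= _ IH.
  have := IH (config g Ph); rewrite hc bc => IHg.
  rewrite -(signature_objects F); apply: S5_zero; apply: IHg.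
  by left; split=> //; left.
case: ifP => [/andP[/eqP-> x1] _ /= IH|_].
  case: Ph x1 IH => [|[|[|x]] Ph] //= _ IH.
  set e' := pack _ in IH *.
  have := IH (config e' (x.+1 :: Ph)); rewrite hc bc => IH1.
  have := IH (config h [:: x.+1, (v (config e' (x.+1 :: Ph))).+1 & Ph]).
  rewrite hc bc => IH2.
  have E : e' = pack [:: 5; signature (objects F (x.+2 :: Ph)); g; h].
    by rewrite signature_objects.
  rewrite {1}E; apply: S5_succ.
    by rewrite -E; apply: IH1; left; split=> //; left.
  by apply: IH2; left; split=> //; right.
case: ifP => [/andP[/eqP-> gs] _ /= IH|_].
  have {IH} := IH _ (or_introl (conj erefl (or_introl erefl))).
  rewrite hc bc /objects /= map_cat -!/(objects _ _) -(signature_objects F).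
  have -> : objects F Ph = objects F (take g Ph) ++
    (if nth 0 Ph g is y.+1 then @obj ty0 y else obj F) ::
      objects F (drop g.+1 Ph).
    by rewrite -{1}(cat_take_drop g Ph) (drop_nth 0 gs) /objects map_cat.
  have : g = size (objects F (take g Ph)).
    by rewrite size_map size_takel // ltnW.
  move: (objects F (take g Ph)) (objects F (drop g.+1 Ph)) (v _) => C D a.
  by case: (nth 0 Ph g) => [|y] -> IHy; apply: S6.
case: ifP => [/andP[/andP[/eqP-> x0] s0] _ /= IH|_].
  case: Ph x0 s0 IH => [|[|x] Ph] //= _ _ IH.
  rewrite -(signature_objects F); apply: (@S8 _ ty1 ty0 F).
  apply: (@applies_cons _ _ _ ty1 ty0 F
    (fun x => v (config g [:: x.+1, 0 & Ph]))).
    case=> x []; have := IH (config g [:: x.+1, 0 & Ph]); rewrite hc bc; apply.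
    by right; left; split=> //; exists x.
  exact: applies_nil.
case: ifP => [/andP[/andP[/eqP-> x1] gs] _ /= IH|_].
  case: Ph x1 gs IH => [|[|x] Ph] //= _ gs IH.
  have := IH (config x (take g Ph)); rewrite hc bc => IHx.
  rewrite -(signature_objects F); apply: S9; first by rewrite size_map.
  by rewrite -map_take; apply: IHx; left; split=> //; left.
by move=> /(_ erefl).
Qed.

(** Taking least values chooses the values of all subcomputations at once. *)
Lemma evals_total F n :
    let v m := least (evals F m) in
    (forall m, need v n m -> exists a, evals F m a) ->
  evals F n (res F v n).
Proof. by move=> v H; apply: Evals => m /H [a /leastP]. Qed.

Lemma least_evals F n a : evals F n a -> least (evals F n) = a.
Proof. by move=> Ha; apply: evals_fun (Ha); exact: leastP Ha. Qed.

Lemma step_at_config e Ph : step_at (config e Ph) = step_of e Ph.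
Proof. by rewrite /step_at packK. Qed.

Lemma evals_ret F n a : step_at n = ret a -> evals F n a.
Proof.
move=> E; have := @evals_total F n; rewrite /res /need E /=; apply.
by move=> m [[]|[[]|[]]].
Qed.

Lemma evals_seq2 F n m1 m2 b a : step_at n = seq2 m1 m2 ->
  evals F m1 b -> evals F (m2 b) a -> evals F n a.
Proof.
move=> E H1 H2; have := @evals_total F n; rewrite /res /need E /=.
rewrite (least_evals H1) (least_evals H2); apply.
by move=> m [[_ [->|->]]|[[]|[]]] //; [exists b | exists a].
Qed.

Lemma evals_app F n d y : step_at n = Step 2 0 d ->
  (forall x, evals F (d x) (y x)) -> evals F n (F y).
Proof.
move=> E H; have := @evals_total F n; rewrite /res /need E /=.
have -> : (fun x => least (evals F (d x))) = y.
  by apply/funext => x; exact: least_evals.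
by apply; move=> m [[]|[[_ [x ->]]|[]]] //; exists (y x).
Qed.

Scheme computes_applies_ind := Minimality for computes Sort Prop
  with applies_computes_ind := Minimality for applies Sort Prop.

(** A copy of [applies] with [P] for [computes], by recursion on the type. For the functional [F] it
    unfolds by computation, where [applies] would require inverting a dependently typed family. *)
Fixpoint applies_by (P : nat -> seq object -> nat -> Prop) Phi
    (ds : seq nat) (s : ftype) {struct s} : interp s -> nat -> Prop :=
  match s with
  | TNat => fun n a => ds = [::] /\ n = a
  | TArr s t => fun G a => if ds is d :: ds' then
      exists2 y : interp s,
        forall xi : args s, P d (objs xi ++ Phi) (app y xi)
        & applies_by P Phi ds' (G y) a
    else False
  end.

Lemma objects_consE F o Phi Ph : o :: Phi = objects F Ph ->
  exists x Ph', [/\ Ph = x :: Ph', Phi = objects F Ph' &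
    o = if x is y.+1 then @obj ty0 y else obj F].
Proof. by case: Ph => //= x Ph' [-> ->]; exists x, Ph'. Qed.

Lemma objects_numberE F x Phi Ph : @obj ty0 x :: Phi = objects F Ph ->
  exists2 Ph', Ph = x.+1 :: Ph' & Phi = objects F Ph'.
Proof.
move=> /objects_consE [[|y] [Ph' [-> -> E]]]; first by have := congr1 tag E.
exists Ph' => //; congr (_.+1 :: _).
pose val (o : object) : nat := if o is existT TNat n then n else 0.
by have /= -> := congr1 val E.
Qed.

Lemma objects_arrowE F s t (G : interp (TArr s t)) Phi Ph :
  obj G :: Phi = objects F Ph ->
  exists2 Ph', Ph = 0 :: Ph' & Phi = objects F Ph' /\ obj G = obj F.
Proof.
by move=> /objects_consE [[|y] [Ph' [-> -> E]]];
  [exists Ph' | have := congr1 tag E].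
Qed.

(** Extending [Q] to all objects by a match allows rewriting with the equality of dependent pairs
    itself, without projecting it to their second components. *)
Lemma obj_arrow_ind (F : interp ty2)
    (Q : forall s t, interp (TArr s t) -> Prop) :
  Q ty1 ty0 F -> forall s t (G : interp (TArr s t)), obj G = obj F -> Q s t G.
Proof.
move=> QF s t G E.
pose Q' (o : object) :=
  match o with existT (TArr s t) H => Q s t H | _ => True end.
by change (Q' (obj G)); rewrite E.
Qed.

Lemma pack_eqE s t : (pack s == pack t) = (s == t).
Proof. exact: (inj_eq pack_inj). Qed.

Lemma computes_evals F e Phi a : computes e Phi a ->
  forall Ph, Phi = objects F Ph -> evals F (config e Ph) a.
Proof.
pose P e Phi a := forall Ph, Phi = objects F Ph -> evals F (config e Ph) a.
move: e Phi a; apply: (@computes_applies_ind P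
   (fun Phi ds s G a => applies_by P Phi ds G a)).
- move=> x Phi Psi Ph EPh; rewrite EPh (signature_objects F).
  have [Ph' -> _] := objects_numberE EPh.
  by apply: evals_ret; rewrite step_at_config /step_of packK !pack_eqE eqxx.
- move=> q Phi Ph ->; rewrite (signature_objects F).
  by apply: evals_ret; rewrite step_at_config /step_of packK !pack_eqE eqxx.
- move=> x Phi Psi Ph EPh; rewrite EPh (signature_objects F).
  have [Ph' -> _] := objects_numberE EPh.
  by apply: evals_ret; rewrite step_at_config /step_of packK !pack_eqE eqxx.
- move=> g h Phi x b _ IHh _ IHg Ph EPh; rewrite EPh (signature_objects F).
  have Eg : @obj ty0 x :: Phi = objects F (x.+1 :: Ph) by rewrite EPh.
  apply: (evals_seq2 _ (IHh _ EPh) (IHg _ Eg)).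
  by rewrite step_at_config /step_of packK !pack_eqE eqxx.
- move=> g h Phi b Psi _ IH Ph EPh; rewrite EPh (signature_objects F).
  have [Ph' -> E] := objects_numberE EPh.
  (* A tail call has a constant branch, so one subcomputation serves as both the first and the
     second. *)
  apply: (evals_seq2 _ (IH _ E) (IH _ E)).
  by rewrite step_at_config /step_of packK !pack_eqE eqxx.
- move=> g h x Phi b c Psi _ IH1 _ IH2 Ph EPh.
  have sg : signature Psi = sig Ph by rewrite EPh signature_objects.
  rewrite sg in IH1 *; have [Ph' EPh' E] := objects_numberE EPh.
  have E1 : @obj ty0 x :: Phi = objects F (x.+1 :: Ph') by rewrite E.
  have E2 : [:: @obj ty0 x, @obj ty0 b & Phi] = objects F [:: x.+1, b.+1 & Ph'].
    by rewrite E.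
  rewrite EPh' in IH1 *; apply: (evals_seq2 _ (IH1 _ E1) (IH2 _ E2)).
  by rewrite step_at_config /step_of packK !pack_eqE eqxx.
- move=> g y Phi Phi' b Psi _ IH Ph EPh; rewrite EPh (signature_objects F).
  have sz : size Phi < size Ph.
    by rewrite -(size_map (fun x => if x is y.+1 then @obj ty0 y else obj F))
      -/(objects F Ph) -EPh size_cat /= addnS ltnS leq_addr.
  have E : y :: Phi ++ Phi' = objects F
      (nth 0 Ph (size Phi) :: take (size Phi) Ph ++ drop (size Phi).+1 Ph).
    rewrite /objects /= map_cat map_take map_drop -!/(objects F Ph) -EPh.
    rewrite /Psi take_size_cat // -cat_rcons drop_size_cat ?size_rcons //.
    congr (_ :: _); rewrite -(nth_map 0 y (fun x =>
      if x is y.+1 then @obj ty0 y else obj F)) // -/(objects F Ph) -EPh.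
    by rewrite /Psi nth_cat ltnn subnn.
  apply: (evals_seq2 _ (IH _ E) (IH _ E)).
  by rewrite step_at_config /step_of packK !pack_eqE eqxx /= sz.
(* S7 cannot occur: its first argument would have to be [F], which has another type. *)
- move=> f x Phi Psi Ph EPh.
  by have [_ _ [_ /(congr1 tag)]] := objects_arrowE EPh.
- move=> ds s t G Phi b Psi _ IH Ph EPh; rewrite EPh (signature_objects F).
  have [Ph' E [_ EG]] := objects_arrowE EPh.
  move: IH; rewrite EPh; move: {Psi EPh} EG; move: s t G.
  apply: (@obj_arrow_ind F (fun s t G => applies_by P (objects F Ph) ds G b ->
    evals F (config (pack [:: 8, sig Ph & ds]) Ph) b)).
  case: ds => //= d ds [y Hy [-> <-]].
  apply: (@evals_app _ _ (fun x => config d (x.+1 :: Ph))).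
    by rewrite step_at_config /step_of packK !pack_eqE eqxx E.
  by move=> x; apply: (Hy (x, tt)).
- move=> m x Phi b Psi le_m _ IH Ph EPh; rewrite EPh (signature_objects F).
  have [Ph' -> E] := objects_numberE EPh.
  have Et : take m Phi = objects F (take m Ph') by rewrite E /objects map_take.
  apply: (evals_seq2 _ (IH _ Et) (IH _ Et)).
  rewrite step_at_config /step_of packK !pack_eqE eqxx /=.
  by move: le_m; rewrite E size_map => ->.
- by [].
- move=> Phi d ds s t G y b _ IH1 _ IH2 /=.
  by exists y.
Qed.

(** * Computability of single steps *)

Definition cmpf P (A : ctx P) (f : P -> nat -> nat) : Prop :=
  cmp (ext A) (fun q => f q.2 q.1).

Lemma cmpf_wk P (A : ctx P) f : cmpf A f -> cmpf (ext A) (fun q => f q.2).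
Proof. exact: cmp_wk1. Qed.

Lemma cmpf_app P (A : ctx P) f t : cmpf A f -> cmp A t ->
  cmp A (fun p => f p (t p)).
Proof. exact: (@cmp_comp _ A (fun q => f q.2 q.1)). Qed.

Lemma cmp_sig P (A : ctx P) s : cmp A (fun p => pack (s p)) ->
  cmp A (fun p => sig (s p)).
Proof.
move=> cs; have csz := cmp_size cs; apply: cmp_pack_nth.
  by apply: cmp_ext csz => p; rewrite size_map.
have c1 := cmp_fst A.
have := cmp_if (dec_le (cmp_succ c1) (cmp_wk csz))
  (cmp_if (dec_eqb (cmp_nth (cmp_wk cs) c1) (cmp_const _ 0))
     (cmp_const _ (ftype_code ty2)) (cmp_const _ (ftype_code ty0)))
  (cmp_const _ 0).
apply: (cmp_ext (A := ext A)) => -[j p] /=; case: ltnP => [lt_j|le_j].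
  by rewrite (nth_map 0).
by rewrite nth_default ?size_map.
Qed.

Definition cmp_step P (A : ctx P) (s : P -> step) : Prop :=
  [/\ cmp A (fun p => kind (s p)), cmp A (fun p => arg (s p)) &
      cmpf A (fun p => branch (s p))].

Lemma cmp_step_if P (A : ctx P) (b : P -> bool) s t :
    dec A b -> cmp_step A s -> cmp_step A t ->
  cmp_step A (fun p => if b p then s p else t p).
Proof.
move=> db [s1 s2 s3] [t1 t2 t3]; split.
- by apply: cmp_ext (cmp_if db s1 t1) => p; case: (b p).
- by apply: cmp_ext (cmp_if db s2 t2) => p; case: (b p).
apply: cmp_ext (cmp_if (dec_wk db) s3 t3) => q.
by case: (b q.2).
Qed.

Lemma cmp_step_Step P (A : ctx P) k a f :
    cmp A a -> cmpf A f -> cmp_step A (fun p => Step k (a p) (f p)).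
Proof. by move=> ca cf; split=> //; exact: cmp_const. Qed.

Ltac list_computability :=
  repeat (cbv beta; first
    [ assumption | exact: cmp_fst
    | apply: dec_andb | apply: dec_le | apply: dec_eqb
    | apply: cmp_pack_cons | apply: cmp_const
    | apply: cmp_succ | apply: cmp_pred | apply: cmp_size | apply: cmp_sig
    | apply: cmp_nth | apply: cmp_head | apply: cmp_behead | apply: cmp_take
    | apply: cmp_drop | apply: cmp_cat | weaken ]).

Lemma cmp_step_of P (A : ctx P) e Ph :
    cmp A e -> cmp A (fun p => pack (Ph p)) ->
  cmp_step A (fun p => step_of (e p) (Ph p)).
Proof.
move=> ce cPh.
have cix := cmp_unpack ce.
have cg := cmp_nth cix (cmp_const A 2).
have ch := cmp_nth cix (cmp_const A 3).
rewrite /step_of /ret /seq2 /tail_call /config /cmpf.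
cbv zeta.
repeat (refine (cmp_step_if _ _ _); [by list_computability | |]).
all: by refine (cmp_step_Step _ _ _); rewrite /cmpf; list_computability.
Qed.

Lemma cmp_step_at P (A : ctx P) n : cmp A n ->
  cmp_step A (fun p => step_at (n p)).
Proof.
move=> /cmp_unpack cn.
by apply: cmp_step_of; [exact: cmp_head | exact: cmp_behead].
Qed.

Lemma cmp_branch P (A : ctx P) n t : cmp A n -> cmp A t ->
  cmp A (fun p => branch (step_at (n p)) (t p)).
Proof.
move=> /cmp_step_at [_ _ cb] ct.
exact: (cmpf_app (f := fun p => branch (step_at (n p))) cb ct).
Qed.

Lemma dec_need P (A : ctx P) v n m : cmpf A v -> cmp A n -> cmp A m ->
  dec A (fun p => need (v p) (n p) (m p)).
Proof.
move=> cv cn cm; have [ck ca cb] := cmp_step_at cn.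
rewrite /need; cbv zeta.
have dk k : dec A (fun p => kind (step_at (n p)) = k).
  exact: dec_eq ck (cmp_const A k).
do ?apply: dec_or; apply: dec_and; try exact: dk; last exact: dec_eq.
- apply: dec_or; apply: dec_eq => //.
  exact: cmp_branch cn (cmpf_app cv ca).
- apply: dec_ex; apply: dec_eq; first exact: cmp_wk.
  by apply: cmp_branch; [exact: cmp_wk | exact: cmp_fst].
Qed.

Lemma cmp_res P (A : ctx P) F v n :
    contains A (F : P -> interp ty2) -> cmpf A v -> cmp A n ->
  cmp A (fun p => res (F p) (v p) (n p)).
Proof.
move=> cF cv cn; have [ck ca cb] := cmp_step_at cn.
rewrite /res; cbv zeta.
refine (cmp_if _ _ _); [exact: dec_eqb ck (cmp_const _ 0) | exact ca | ].
refine (cmp_if _ _ _); [exact: dec_eqb ck (cmp_const _ 1) | | ].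
  exact: cmpf_app cv (cmp_branch cn (cmpf_app cv ca)).
refine (cmp_if _ _ (cmp_const _ 0)); first exact: dec_eqb ck (cmp_const _ 2).
apply: (cmp_app2 cF (t := fun p x => v p (branch (step_at (n p)) x))).
by apply: cmpf_app (cmpf_wk cv) _.
Qed.

(** * Well-founded parts *)

Definition pair (n a : nat) : nat := pack [:: n; a].

(* A function [f] is read as the characteristic function of the graph of a
   partial function from configurations to values. *)
Definition value (f : nat -> nat) (n : nat) : nat :=
  least (fun a => f (pair n a) <> 0).

(** The first conjunct guards against the default: [value f n] is 0 when [f] contains no pair for
    [n], and 0 may happen to be the right value. *)
Definition correct F f n : Prop :=
  f (pair n (res F (value f) n)) <> 0 /\ value f n = res F (value f) n.

(** An incorrect configuration descends to everything, in particular to itself, and so is never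
    grounded. *)
Definition descends F f n m : Prop := need (value f) n m \/ ~ correct F f n.

Definition grounded F f n : Prop :=
  ~ exists g : nat -> nat, g 0 = n /\ forall k, descends F f (g k) (g k.+1).

Definition ready F f n : Prop :=
  forall m, need (value f) n m -> grounded F f m.

(* Every [k] with this property bounds a disagreement of [f] with the graph of
   [evals F]. *)
Definition refutes F f k : Prop :=
  exists n, [/\ ready F f n, ~ grounded F f n,
    pair n (res F (value f) n) < k & pair n (value f n) < k].

Definition modulus F f : nat := least (refutes F f).

Lemma grounded_step F f n m :
  grounded F f n -> descends F f n m -> grounded F f m.
Proof.
move=> Wn nm [g [g0 gP]]; apply: Wn.
exists (fun k => if k is k'.+1 then g k' else n); split=> // -[|k] //.
by rewrite g0.
Qed.

Lemma grounded_correct F f n : grounded F f n -> correct F f n.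
Proof.
move=> Wn; apply: contrapT => nc; apply: Wn; exists (fun=> n); split=> // _.
by right.
Qed.

Lemma grounded_ready F f n : correct F f n -> ready F f n -> grounded F f n.
Proof.
move=> cn rn [g [g0 gP]].
have [nm|nc] := gP 0; last by rewrite g0 in nc; apply: nc.
rewrite g0 in nm; apply: (rn _ nm).
by exists (fun k => g k.+1); split=> [|k]; [reflexivity | exact: gP].
Qed.

(** If [Q] fails at [n], a choice function picks a descent to another failure each time, and its
    iterates form an infinite path from [n]. *)
Lemma grounded_ind F f (Q : nat -> Prop) :
    (forall n, (forall m, descends F f n m -> Q m) -> Q n) ->
  forall n, grounded F f n -> Q n.
Proof.
move=> IH n Wn; apply: contrapT => nQ; apply: Wn.
have /choice [h hP] : forall m, exists k, ~ Q m -> descends F f m k /\ ~ Q k.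
  move=> m; have [Qm|nQm] := EM (Q m); first by exists 0.
  have /existsNP [k /not_implyP mk] : ~ forall k, descends F f m k -> Q k.
    by move=> /IH.
  by exists k.
have nQk k : ~ Q (iter k h n) by elim: k => //= k /hP [].
by exists (fun k => iter k h n); split=> // k; have [] := hP _ (nQk k).
Qed.

Lemma grounded_evals F f n : grounded F f n -> evals F n (value f n).
Proof.
move=> Wn; move: (Wn).
apply: (@grounded_ind F f (fun m => grounded F f m -> evals F m (value f m)))
  Wn => {}n IH Wn.
have [_ ->] := grounded_correct Wn; apply: Evals => m nm.
have dm : descends F f n m by left.
apply: (IH _ dm); exact: grounded_step Wn dm.
Qed.

Lemma ready_evals F f n : ready F f n -> evals F n (res F (value f) n).
Proof. by move=> rn; apply: Evals => m /rn/grounded_evals. Qed.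

Lemma evals_grounded F f n a : (forall m, ready F f m -> grounded F f m) ->
  evals F n a -> grounded F f n.
Proof.
move=> rg; elim=> {a}n v Hv IH; apply: (rg) => m nm; apply: (IH).
(* By induction the configurations in [need v n] are grounded, so [f] gives them their true values
   and [need (value f) n] is no larger. *)
have agree k : need v n k -> value f k = v k.
  move=> vk; apply: evals_fun (grounded_evals (IH _ vk)) (Hv _ vk).
by apply: need_local nm => k1; apply: agree; exact: need_arg.
Qed.

Definition graph F (c : nat) : nat :=
  if `[< exists n a, c = pair n a /\ evals F n a >] then 1 else 0.

Lemma graphP F n a : graph F (pair n a) <> 0 <-> evals F n a.
Proof.
rewrite /graph; case: asboolP => [[n' [a' [/pack_inj[-> ->]]]]|nE] //.
by split=> // ev; case: nE; exists n, a.
Qed.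

(** A refuting configuration has both its correct pair and the pair read from [f] below the modulus.
    There [f] is the graph, so both pairs belong to the graph and coincide; the configuration is
    then correct, hence grounded. *)
Lemma not_refuted F f :
    (forall c, c < modulus F f -> f c = graph F c) ->
  forall n, ready F f n -> grounded F f n.
Proof.
move=> agree n rn; apply: contrapT => nW.
have : refutes F f (modulus F f).
  (* Some bound exceeds both pairs of [n], so the least bound refutes [f] too, though perhaps
     through a different configuration [k]. *)
  apply: leastP (maxn (pair n (res F (value f) n)) (pair n (value f n))).+1 _.
  by exists n; split; rewrite // ltnS leq_max leqnn ?orbT.
move=> [k [rk nWk lt1 lt2]]; have ev := ready_evals rk.
apply: nWk; apply: grounded_ready rk.
have f1 : f (pair k (res F (value f) k)) <> 0 by rewrite agree //; apply/graphP.
split=> //; apply: evals_fun ev; apply/graphP; rewrite -agree //.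
exact: (leastP (Q := fun a => f (pair k a) <> 0) f1).
Qed.

(** * Deciding the grounded configurations *)

Lemma cmp_pair P (A : ctx P) n a : cmp A n -> cmp A a ->
  cmp A (fun p => pair (n p) (a p)).
Proof. by move=> cn ca; rewrite /pair; computability. Qed.

Lemma cmp_value P (A : ctx P) f n : cmpf A f -> cmp A n ->
  cmp A (fun p => value (f p) (n p)).
Proof.
move=> cf cn; apply: (cmp_least (Q := fun p a => f p (pair (n p) a) <> 0)).
apply: dec_not; apply: dec_zero; apply: cmpf_app (cmpf_wk cf) _.
exact: cmp_pair (cmp_wk cn) (cmp_fst _).
Qed.

Lemma cmpf_value P (A : ctx P) f : cmpf A f -> cmpf A (fun p => value (f p)).
Proof. by move=> cf; apply: cmp_value (cmpf_wk cf) (cmp_fst _). Qed.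

Lemma dec_descends P (A : ctx P) F f n m :
    contains A (F : P -> interp ty2) -> cmpf A f -> cmp A n -> cmp A m ->
  dec A (fun p => descends (F p) (f p) (n p) (m p)).
Proof.
move=> cF cf cn cm; have cv := cmpf_value cf.
have cr := cmp_res cF cv cn.
apply: dec_or; first exact: dec_need.
apply: dec_not; apply: dec_and; last exact: dec_eq (cmp_value cf cn) cr.
by apply: dec_not; apply: dec_zero; apply: cmpf_app cf _; exact: cmp_pair.
Qed.

Lemma dec_grounded P (A : ctx P) F f n :
    contains A (F : P -> interp ty2) -> cmpf A f -> cmp A n ->
  dec A (fun p => grounded (F p) (f p) (n p)).
Proof.
move=> cF cf cn; apply: dec_not.
(* The Suslin quantifier sees only initial segments, so [R] states that the segment coded by [c]
   starts at [n p], if nonempty, and descends as far as it reaches. *)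
pose R p c := (0 < size (unpack c) -> nth 0 (unpack c) 0 = n p) /\
  forall k, k.+1 < size (unpack c) ->
    descends (F p) (f p) (nth 0 (unpack c) k) (nth 0 (unpack c) k.+1).
apply: (dec_ext (R := fun p => exists g, forall k, R p (pack (mkseq g k)))).
  move=> p; split=> -[g gP]; exists g.
    split; first by have [+ _] := gP 1; rewrite packK; apply.
    move=> k; have [_ /(_ k)] := gP k.+2.
    by rewrite packK size_mkseq !nth_mkseq //; apply.
  case: gP => g0 gP k; split; rewrite packK size_mkseq.
    by move=> k0; rewrite nth_mkseq.
  by move=> i lt_ik; rewrite !nth_mkseq // ltnW.
apply: dec_suslin.
have cc := cmp_unpack (cmp_fst A); have cs := cmp_size cc.
apply: dec_and.
  apply: dec_imp; first exact: dec_le (cmp_const _ 1) cs.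
  exact: dec_eq (cmp_nth cc (cmp_const _ 0)) (cmp_wk cn).
apply: (dec_all (R := fun q k => k.+1 < size (unpack q.1) ->
  descends (F q.2) (f q.2) (nth 0 (unpack q.1) k) (nth 0 (unpack q.1) k.+1))).
have c1 := cmp_fst (ext A).
apply: dec_imp; first exact: dec_le (cmp_succ (cmp_succ c1)) (cmp_wk cs).
have cF2 : contains (ext (ext A)) (fun q => F q.2.2 : interp ty2).
  exact: (contains_ext ty0 (contains_ext ty0 cF)).
apply: dec_descends cF2 (cmpf_wk (cmpf_wk cf)) _ _;
  by apply: cmp_nth (cmp_wk cc) _ => //; exact: cmp_succ.
Qed.

Lemma cmp_modulus P (A : ctx P) F f :
    contains A (F : P -> interp ty2) -> cmpf A f ->
  cmp A (fun p => modulus (F p) (f p)).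
Proof.
move=> cF cf; apply: cmp_least.
rewrite /refutes.
apply: (dec_ext (R := fun q => exists n,
   (ready (F q.2) (f q.2) n /\ ~ grounded (F q.2) (f q.2) n) /\
   (pair n (res (F q.2) (value (f q.2)) n) < q.1 /\
    pair n (value (f q.2) n) < q.1))).
  by move=> q; split=> -[n]; [case=> -[? ?] [? ?] | case]; exists n.
apply: dec_ex.
have cF2 : contains (ext (ext A)) (fun q => F q.2.2 : interp ty2).
  exact: (contains_ext ty0 (contains_ext ty0 cF)).
have cF3 : contains (ext (ext (ext A))) (fun q => F q.2.2.2 : interp ty2).
  exact: (contains_ext ty0 cF2).
have cf2 := cmpf_wk (cmpf_wk cf); have cf3 := cmpf_wk cf2.
have c1 := cmp_fst (ext A); have c2 := cmp_wk (cmp_fst A).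
apply: dec_and; apply: dec_and.
- apply: dec_all; apply: dec_imp.
    exact: dec_need (cmpf_value cf3) (cmp_wk c1) (cmp_fst _).
  exact: dec_grounded cF3 cf3 (cmp_fst _).
- by apply: dec_not; exact: dec_grounded cF2 cf2 c1.
- apply: dec_le c2; apply: cmp_succ; apply: cmp_pair (c1) _.
  exact: cmp_res cF2 (cmpf_value cf2) c1.
- apply: dec_le c2; apply: cmp_succ; apply: cmp_pair (c1) _.
  exact: cmp_value cf2 c1.
Qed.

(** * The superjump *)

Lemma In_nth_seq (T : Type) (d x : T) s :
  List.In x s -> exists i, nth d s i = x.
Proof.
elim: s => //= y s IH [<-|/IH [i <-]]; [by exists 0 | by exists i.+1].
Qed.

(** [SCF] at [graph F] yields an entry that is not refuted, for which every terminating
    configuration is grounded. Conversely, groundedness for any function whatever implies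
    termination, so indices [i] beyond the length of the list, where the entry is the zero function,
    do no harm. *)
Lemma terminates_grounded (Theta : interp ty2 -> seq (interp ty1)) F e :
    SCF Theta ->
  terminates e [:: @obj ty2 F] <->
  exists i, grounded F (nth (fun=> 0) (Theta (modulus F)) i) (config e [:: 0]).
Proof.
move=> scf; split=> [[a /computes_evals ev]|[i /grounded_evals/evals_computes]].
  have {}ev := ev F [:: 0] erefl.
  have [|g [g_in eq_g]] := scf (modulus F) (graph F).
    by move=> c; rewrite /graph; case: ifP.
  have [i gi] := In_nth_seq (fun=> 0) g_in.
  exists i; rewrite gi; apply: (evals_grounded _ ev) => n.
  apply: (not_refuted (f := g)) => c lt_c.
  by have := congr1 (nth 0 ^~ c) eq_g; rewrite !nth_mkseq.
rewrite packK => ev; eexists; exact: ev.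
Qed.

Theorem theorem4p1 (Theta : interp ty2 -> seq (interp ty1))
  (hTheta : SCF Theta) :
  computable_in (seq_functional Theta ++ [:: @obj ty2 suslin])
    (superjump : interp (TArr ty2 (TArr ty0 ty0))).
Proof.
pose P := args (TArr ty2 (TArr ty0 ty0)).
(* The order is: length function, entry function, Suslin functional, [F], [e]. The positions 1 to 4
   used below refer to it. *)
pose l (p : P) := (seq_functional Theta ++ [:: @obj ty2 suslin]) ++ objs p.
have uni : uniform l by exists (types (l (fun=> 0, (0, tt)))) => p.
have cS : contains l (fun=> suslin : interp ty2).
  by exists 2, (fun=> seq_functional Theta), (fun p : P => objs p).
pose A : ctx P := Ctx uni cS.
suff [e eP] : cmp A (fun p : P => superjump p.1 p.2.1) by exists e.
have cT : contains A (fun=> (fun G i => nth (fun=> 0) (Theta G) i) :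
    interp (TArr ty2 (TArr ty0 ty1))).
  exists 1, (fun=> [:: @obj (TArr ty2 ty0) (fun G => size (Theta G))]),
    (fun p : P => @obj ty2 suslin :: objs p).
  by [].
have cF : contains A (fun p : P => p.1 : interp ty2).
  exists 3, (fun=> seq_functional Theta ++ [:: @obj ty2 suslin]),
    (fun p : P => [:: @obj ty0 p.2.1]).
  by [].
have ce : cmp A (fun p : P => p.2.1).
  apply: cmp_contains; exists 4, (fun p => seq_functional Theta ++
    [:: @obj ty2 suslin; @obj ty2 p.1]), (fun=> [::]).
  by [].
(* The superjump is by definition the truth value of termination. *)
apply: (dec_ext (R := fun p : P => exists i, grounded p.1
   (nth (fun=> 0) (Theta (modulus p.1)) i) (config p.2.1 [:: 0]))).
  by move=> p; rewrite -terminates_grounded.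
apply: dec_ex; apply: dec_grounded.
- exact: (contains_ext ty0 cF).
(* The variables of [q] are the place at which the entry is evaluated, the index [i], and then [p];
   hence [q.2.2.1] is [F]. The functional [modulus F] is passed by S8, with its type-1 argument as a
   new variable. *)
- apply: (cmp_app3 (T := fun _ G i => nth (fun=> 0) (Theta G) i)
    (G := fun q f => modulus q.2.2.1 f)).
  + exact: (contains_ext ty0 (contains_ext ty0 cT)).
  + apply: (@cmp_modulus _ (exts ty1 (ext (ext A)))).
      exact: (contains_ext ty1 (contains_ext ty0 (contains_ext ty0 cF))).
    apply: (@cmp_app1 _ (ext (exts ty1 (ext (ext A)))) (fun q => q.2.1)).
      exact: (contains_ext ty0 (contains_ext0 (ext (ext A)) ty1)).
    exact: cmp_fst.
  + by apply: cmp_wk; exact: cmp_fst.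
  + exact: cmp_fst.
- apply: (cmp_pack_cons (s := fun=> [:: 0]) (cmp_wk ce)).
  exact: cmp_const.
Qed.
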